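(* Let $k$ be odd and let $\phi$ be a monotone $[k]$-edge-labeling of $K^{(2)}_n$ that minimizes the number of bad triples among all monotone $[k]$-edge-labelings of $K^{(2)}_n$. Then the number of bad triples of $\phi$ is at least $(1-o(1))\frac{4}{(k+1)^2}\binom{n}{3}$, where $o(1)\to0$ as $n\to\infty$ with $k$ fixed.
   Context: $K^{(2)}_n$ is the complete graph on $[n]$ with its natural order. A $[k]$-edge-labeling $\phi$ assigns to each pair $uv$ ($u<v$) a label $\phi(uv)\in\{1,\dots,k\}$; it is monotone if $\phi(uv)\le\phi(vw)$ whenever $u<v<w$. A triple $u<v<w$ is good if $\phi(uv)<\phi(vw)$ and bad otherwise. *)

(* Defs.v *)
From mathcomp Require Import all_boot all_order all_algebra.
Set Implicit Arguments. Unset Strict Implicit. Unset Printing Implicit Defensive.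

(* A [k]-edge-labeling of K_n: labels of pairs uv with u < v.  Vertices are
   'I_n = {0,...,n-1} with natural order; labels are 'I_k = {0,...,k-1},
   an order-isomorphic shift of {1,...,k}.  Values phi u v with u >= v are
   irrelevant (never used). *)
Definition labeling (n k : nat) := 'I_n -> 'I_n -> 'I_k.

Definition monotone (n k : nat) (phi : labeling n k) : Prop :=
  forall u v w : 'I_n, (u < v < w)%N -> (phi u v <= phi v w)%N.

Definition bad_triples (n k : nat) (phi : labeling n k) : {set 'I_n * 'I_n * 'I_n} :=
  [set t : 'I_n * 'I_n * 'I_n |
     [&& (t.1.1 < t.1.2)%N, (t.1.2 < t.2)%N & ~~ (phi t.1.1 t.1.2 < phi t.1.2 t.2)%N]].

Definition nbad (n k : nat) (phi : labeling n k) : nat := #|bad_triples phi|.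

(* Main.v *)
Require Import Defs.
From mathcomp Require Import all_boot all_order all_algebra.
From mathcomp Require Import zify lra.
Import Order.TTheory GRing.Theory Num.Theory.
Local Open Scope ring_scope.
Set Implicit Arguments. Unset Strict Implicit. Unset Printing Implicit Defensive.

(** Let [c v] be the largest label of an edge entering [v].  Monotonicity gives
    [c u <= phi u v <= c v] for [u < v], and every pair consisting of an
    in-edge and an out-edge of [v] that both carry the label [c v] is bad.  Let
    [z v] and [y v] be the numbers of such in- and out-edges, exchanged when
    [c v] is odd.  The labels split into (k+1)/2 groups of at most two
    consecutive labels, [{0}, {1,2}, {3,4}, ...] for [z] and
    [{0,1}, {2,3}, ...] for [y], and every edge between two vertices of one
    group is counted at one of its ends.  With [K = (k+1)/2], Cauchy-Schwarz
    thus bounds the sum of [2z+1], and that of [2y+1], over any vertex set [X]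
    from below by [#|X|^2 / K].  Two summations by parts turn these bounds into
    a bound [(2n^3+n) / (3K^2)] for the sum of [(2z+1)(2y+1)] over all vertices,
    whose main term is four times the sum of [z y]. *)

(** * Sums over vertex sets: Cauchy-Schwarz and summation by parts *)

Section SubsetSums.

Local Open Scope nat_scope.

(** Cauchy-Schwarz against the constant vector, from [2xy <= x^2 + y^2] summed over all pairs of
    indices. *)
Lemma sqr_sum_le (K : nat) (x : 'I_K -> nat) :
  (\sum_g x g) ^ 2 <= K * \sum_g x g ^ 2.
Proof.
suff: 2 * (\sum_g x g) ^ 2 <= 2 * (K * \sum_g x g ^ 2) by rewrite leq_pmul2l.
have -> : 2 * (K * \sum_g x g ^ 2) = \sum_g \sum_h (x g ^ 2 + x h ^ 2).
  under [RHS]eq_bigr do rewrite big_split /= sum_nat_const card_ord.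
  by rewrite big_split /= -big_distrr sum_nat_const card_ord /= mul2n addnn.
rewrite -mulnn big_distrlr big_distrr /=; apply: leq_sum => g _.
by rewrite big_distrr; apply: leq_sum => h _; exact: nat_Cauchy.
Qed.

(* If [r] meets every pair of distinct elements of a common group, its
   out-degrees have large sums over all subsets. *)
Lemma sqr_card_le_sum_degree (T : finType) (K : nat) (f : T -> 'I_K)
    (r : rel T) (X : {set T}) :
  (forall u v, u != v -> f u = f v -> r u v || r v u) ->
  #|X| ^ 2 <= K * \sum_(v in X) (2 * #|[set u | r v u]| + 1).
Proof.
move=> r_total.
have -> : #|X| = \sum_g \sum_(v in X) (f v == g).
  rewrite exchange_big /= -sum1_card; apply: eq_bigr => v _.
  by rewrite (bigD1 (f v)) //= eqxx big1 ?addn0 // => g /negPf; rewrite eq_sym => ->.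
apply: leq_trans (sqr_sum_le _) _; rewrite leq_mul2l; apply/orP; right.
(* Squared group sizes count the ordered pairs lying in a common group. *)
have -> : \sum_g (\sum_(v in X) (f v == g)) ^ 2 =
    \sum_(v in X) \sum_(u in X) (f v == f u).
  under eq_bigr do rewrite -mulnn big_distrlr /=.
  rewrite exchange_big; apply: eq_bigr => v _.
  rewrite exchange_big; apply: eq_bigr => u _ /=.
  rewrite (bigD1 (f v)) //= eqxx mul1n big1 ?addn0 1?eq_sym // => g /negPf.
  by rewrite eq_sym => ->.
have degE v : \sum_(u in X) (r v u : nat) <= #|[set u | r v u]|.
  by rewrite -sum1dep_card big_mkcond [leqRHS]big_mkcond; apply: leq_sum => u _;
     case: (u \in X); case: (r v u).
apply: (@leq_trans (\sum_(v in X) \sum_(u in X) (r v u + r u v + (u == v)))).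
  apply: leq_sum => v _; apply: leq_sum => u _.
  case: (eqVneq u v) => [-> | neq_uv]; first by rewrite eqxx addn1 ltnS.
  case: eqP => // fvu; have := r_total _ _ neq_uv (esym fvu).
  by case: (r u v); case: (r v u).
(* Swapping the summation order identifies the two [r] terms, hence the factor 2; the diagonal gives
   the [+ 1]. *)
have -> : \sum_(v in X) \sum_(u in X) (r v u + r u v + (u == v)) =
    \sum_(v in X) (2 * (\sum_(u in X) (r v u : nat)) + 1).
  under eq_bigr do rewrite !big_split /=.
  rewrite !big_split /= [X in _ + X + _ = _]exchange_big /=.
  rewrite [X in _ = _ + (_ + X) + _]big1_eq addn0; congr (_ + _); apply: eq_bigr => v vX.
  by rewrite (bigD1 v) //= eqxx big1 ?addn0 // => u /andP[_ /negPf ->].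
by apply: leq_sum => v _; rewrite leq_add2r leq_mul2l degE.
Qed.

Variables (T : finType) (K : nat).

Lemma sum_ltn_indicator (a M : nat) : a <= M -> \sum_(c < M) (c < a) = a.
Proof.
move=> aM; rewrite -(big_mkord xpredT (fun c => (c < a) : nat)).
transitivity (\sum_(0 <= c < M | true && (c < a)) 1).
  by rewrite [RHS]big_mkcond; apply: eq_bigr => c _; case: (c < a).
by rewrite -(big_nat_widen _ _ _ xpredT) // sum_nat_const_nat subn0 muln1.
Qed.

(* Layer-cake decomposition of [Z]. *)
Lemma sum_min_le_sum_mul (Z Y : T -> nat) :
  (forall X : {set T}, #|X| ^ 2 <= K * \sum_(v in X) Y v) ->
  \sum_u \sum_v minn (Z u) (Z v) <= K * \sum_v Z v * Y v.
Proof.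
move=> hY; pose M := \max_v Z v.
have ZM v : Z v <= M by exact: leq_bigmax.
(* [minn (Z u) (Z v)] is the number of thresholds lying below both values. *)
have -> : \sum_u \sum_v minn (Z u) (Z v) =
    \sum_(c < M) #|[set v | c < Z v]| ^ 2.
  transitivity (\sum_u \sum_v \sum_(c < M) ((c < Z u) * (c < Z v))).
    apply: eq_bigr => u _; apply: eq_bigr => v _.
    rewrite -[LHS](@sum_ltn_indicator _ M) ?geq_min ?ZM //.
    by apply: eq_bigr => c _; rewrite leq_min mulnb.
  under eq_bigr do rewrite exchange_big /=.
  rewrite exchange_big; apply: eq_bigr => c _ /=.
  rewrite -sum1dep_card [X in _ = X ^ 2]big_mkcond -mulnn big_distrlr /=.
  by apply: eq_bigr => u _; apply: eq_bigr => v _; case: (c < Z u); case: (c < Z v).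
have -> : \sum_v Z v * Y v = \sum_(c < M) \sum_(v in [set v | c < Z v]) Y v.
  transitivity (\sum_v \sum_(c < M) (c < Z v) * Y v).
    by apply: eq_bigr => v _; rewrite -big_distrl /= sum_ltn_indicator.
  rewrite exchange_big; apply: eq_bigr => c _ /=.
  rewrite [RHS]big_mkcond; apply: eq_bigr => v _.
  by rewrite inE; case: (c < Z v); rewrite ?mul1n ?mul0n.
by rewrite big_distrr; apply: leq_sum => c _; exact: hY.
Qed.

(* Induction on [X], removing an element where [Z] is maximal. *)
Lemma cube_le_sum_min (Z : T -> nat) (X : {set T}) :
  (forall X : {set T}, #|X| ^ 2 <= K * \sum_(v in X) Z v) ->
  2 * #|X| ^ 3 + #|X| <= 3 * (K * \sum_(u in X) \sum_(v in X) minn (Z u) (Z v)).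
Proof.
move=> hZ; have [m] := ubnP #|X|; elim: m X => // m IH X Xm.
have [-> | [x0 x0X]] := set_0Vmem X; first by rewrite cards0.
have [x xX xmax] : exists2 x, x \in X & forall v, v \in X -> Z v <= Z x.
  by case: (arg_maxnP Z x0X) => x xX xmax; exists x.
pose X' := X :\ x.
have cX : #|X| = #|X'|.+1 by rewrite (cardsD1 x) xX.
have {}IH := IH X' ltac:(by rewrite cX in Xm).
have sumE (F : T -> nat) : \sum_(v in X) F v = F x + \sum_(v in X') F v.
  by rewrite (big_setD1 x).
(* By maximality of [Z x], the row and the column of [x] each contribute the sum of [Z] over [X'],
   and the diagonal entry [Z x] completes one of them to [X]. *)
have -> : \sum_(u in X) \sum_(v in X) minn (Z u) (Z v) =
    \sum_(u in X') \sum_(v in X') minn (Z u) (Z v)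
    + \sum_(v in X') Z v + \sum_(v in X) Z v.
  rewrite !sumE minnn; under [X in _ + _ + X = _]eq_bigr do rewrite sumE.
  rewrite big_split /=.
  have leZ v : v \in X' -> Z v <= Z x by rewrite inE => /andP[_ /xmax].
  rewrite (eq_bigr Z) => [|v /leZ]; last by move=> ?; rewrite (minn_idPr _).
  rewrite [X in _ + (X + _) = _](eq_bigr Z) => [|v /leZ]; last first.
    by move=> ?; rewrite (minn_idPl _).
  by lia.
(* With [m = #|X'|], the increment of [2m^3 + m] is exactly [3((m+1)^2 + m^2)]. *)
have := hZ X; have := hZ X'; rewrite cX !mulnDr.
by move: IH; rewrite !expnS !expn0 !muln1; nia.
Qed.

(** Each of the two summations by parts, first with [Z] and then with [Y], costs one factor [K]. *)
Lemma cube_le_sum_mul (Z Y : T -> nat) :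
  (forall X : {set T}, #|X| ^ 2 <= K * \sum_(v in X) Z v) ->
  (forall X : {set T}, #|X| ^ 2 <= K * \sum_(v in X) Y v) ->
  2 * #|T| ^ 3 + #|T| <= 3 * (K ^ 2 * \sum_v Z v * Y v).
Proof.
move=> hZ hY; have := cube_le_sum_min [set: T] hZ; rewrite cardsT => /leq_trans -> //.
rewrite leq_mul2l /= -mulnn -mulnA leq_mul2l; apply/orP; right.
apply: leq_trans (sum_min_le_sum_mul Z hY).
rewrite big_mkcond /=; apply/eq_leq/eq_bigr => u _; rewrite inE.
by rewrite big_mkcond /=; apply: eq_bigr => v _; rewrite inE.
Qed.

End SubsetSums.

(** * Critical edges of a monotone labeling *)

Section MonotoneLabeling.

Local Open Scope nat_scope.

Variables (n k : nat) (phi : labeling n k).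
Hypothesis phi_mono : monotone phi.

(** The empty maximum gives 0 at the first vertex, so [max_in_le_label] holds there too. *)
Definition max_in_label (v : 'I_n) : nat := \max_(u < n | u < v) phi u v.
Local Notation c := max_in_label.

Lemma label_le_max_in (u v : 'I_n) : u < v -> phi u v <= c v.
Proof. by move=> uv; rewrite /max_in_label (bigD1 u) //= leq_maxl. Qed.

Lemma max_in_le_label (u v : 'I_n) : u < v -> c u <= phi u v.
Proof.
by move=> uv; apply/bigmax_leqP => w wu; apply: phi_mono; rewrite wu uv.
Qed.

Lemma max_in_lt (v : 'I_n) : 0 < k -> c v < k.
Proof.
by move=> k0; rewrite -(prednK k0) ltnS; apply/bigmax_leqP => u _;
   rewrite -ltnS prednK.
Qed.

(* [critical b v u]: the edge [uv] has label [c v] and, according to the parity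
   of [c v] compared with [b], enters or leaves [v]. *)
Definition critical (b : bool) : rel 'I_n := fun v u =>
  if odd (c v) == b then (u < v) && (phi u v == c v :> nat)
  else (v < u) && (phi v u == c v :> nat).

(** The parity exchange does not affect the product, and each pair of an in-edge and an out-edge
    labeled [c v] is a bad triple with middle vertex [v]. *)
Lemma sum_critical_le_nbad :
  \sum_v #|[set u | critical false v u]| * #|[set u | critical true v u]|
  <= nbad phi.
Proof.
pose A (v : 'I_n) := [set u : 'I_n | (u < v) && (phi u v == c v :> nat)].
pose B (v : 'I_n) := [set w : 'I_n | (v < w) && (phi v w == c v :> nat)].
have -> : \sum_v #|[set u | critical false v u]| * #|[set u | critical true v u]|
    = \sum_v #|A v| * #|B v|.
  by apply: eq_bigr => v _; rewrite /critical; case: (odd (c v)); rewrite //= mulnC.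
have -> : \sum_v #|A v| * #|B v| =
    \sum_v \sum_u \sum_w ((u \in A v) && (w \in B v)).
  apply: eq_bigr => v _; rewrite -!sum1_card big_mkcond [X in _ * X]big_mkcond /=.
  rewrite big_distrlr /=; apply: eq_bigr => u _; apply: eq_bigr => w _.
  by case: (u \in A v); case: (w \in B v).
rewrite exchange_big /= pair_bigA pair_bigA /= /nbad -sum1_card [leqRHS]big_mkcond.
apply: leq_sum => -[[u v] w] _ /=; rewrite !inE /=.
case: andP => // -[/andP[-> /eqP uv] /andP[-> /eqP vw]] /=.
by rewrite uv vw ltnn.
Qed.

(** The halved value is the index of the group. For [u < v] in one group, the edge carries the label
    [c u] or [c v]. In a two-label group the smaller label counts out-edges and the larger one
    in-edges, so the edge is counted at [u] or at [v]. *)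
Lemma critical_total (b : bool) (u v : 'I_n) : u != v ->
  (c u + ~~ b)./2 = (c v + ~~ b)./2 -> critical b u v || critical b v u.
Proof.
wlog uv : u v / u < v => [hwlog neq_uv eq_uv | _ eq_uv].
  case: (ltngtP u v) => [| |/val_inj eq]; first by move/hwlog; apply.
    by rewrite orbC; move/hwlog; apply; rewrite // eq_sym.
  by rewrite eq eqxx in neq_uv.
have := label_le_max_in uv; have := max_in_le_label uv.
rewrite /critical uv (ltnNge v u) (ltnW uv) /= => cu cv.
move: (c u) (c v) (nat_of_ord (phi u v)) eq_uv cu cv => p q l.
by case: b; case: (boolP (odd p)) => op; case: (boolP (odd q)) => oq /=; lia.
Qed.

Lemma nbad_lower_bound : odd k ->
  2 * n ^ 3 <= 3 * (k./2.+1 ^ 2 * (4 * nbad phi + 5 * n ^ 2)).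
Proof.
move=> k_odd; have k_gt0 : 0 < k by case: (k) k_odd.
have crit_sum (b : bool) (X : {set 'I_n}) :
    #|X| ^ 2 <= k./2.+1 * \sum_(v in X) (2 * #|[set u | critical b v u]| + 1).
  have grp_lt v : (c v + ~~ b)./2 < k./2.+1.
    by have := max_in_lt v k_gt0; case: b => /=; lia.
  apply: (@sqr_card_le_sum_degree _ _ (fun v => Ordinal (grp_lt v))) => u v uv.
  by case=> /(critical_total uv).
have := cube_le_sum_mul (crit_sum false) (crit_sum true).
rewrite card_ord => hcube; apply: leq_trans (leq_trans (leq_addr _ _) hcube) _.
rewrite !leq_mul2l /=.
(* Since [z, y <= n] and [1 <= n], [(2z+1)(2y+1) <= 4zy + 4n + 1 <= 4zy + 5n]. *)
apply: (@leq_trans (\sum_v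
    (4 * (#|[set u | critical false v u]| * #|[set u | critical true v u]|)
     + 5 * n))).
  apply: leq_sum => v _.
  have leqn b : #|[set u | critical b v u]| <= n.
    by rewrite -[leqRHS]card_ord max_card.
  have n_gt0 : 0 < n := leq_ltn_trans (leq0n v) (ltn_ord v).
  by move: (leqn false) (leqn true); move: #|_| #|_| => a b; nia.
rewrite big_split /= -big_distrr /= sum_nat_const card_ord.
by rewrite leq_add ?leq_mul2l ?sum_critical_le_nbad // mulnCA mulnn.
Qed.

End MonotoneLabeling.

(** * Passage to the asymptotic bound *)

Lemma bin3_le_cube (n : nat) : (6 * 'C(n, 3) <= n ^ 3)%N.
Proof.
have := bin_ffact n 3; rewrite (_ : 3`! = 6)%N // mulnC => ->.
rewrite !ffactnS ffactn0 muln1; case: n => [|[|n]] //=.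
by rewrite !expnS expn0 muln1; nia.
Qed.

Theorem theorem4p11 (k : nat) :
  odd k ->
  forall eps : rat, 0 < eps ->
  exists N : nat, forall n : nat, (N <= n)%N ->
  forall phi : labeling n k,
    monotone phi ->
    (forall psi : labeling n k, monotone psi -> (nbad phi <= nbad psi)%N) ->
    (1 - eps) * (4%:R / ((k + 1)%:R ^+ 2)) * ('C(n, 3))%:R <= (nbad phi)%:R.
Proof.
move=> k_odd eps eps_gt0.
pose K := (k./2.+1)%:R : rat.
have K_gt0 : 0 < K by rewrite ltr0n.
(* Absorbing the error [5 K^2 n^2 / 4] into [eps n^3 / 6] takes [15 K^2 / 2 <= eps n]; 8 rounds this
   up. *)
exists (Num.bound (8 * K ^+ 2 / eps)) => n Nn phi phi_mono _.
have -> : 4%:R / ((k + 1)%:R ^+ 2) = K ^- 2.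
  have -> : (k + 1)%:R = 2 * K by rewrite /K -natrM; congr (_%:R); lia.
  by rewrite exprMn invfM mulrA -natrX divff ?mul1r.
have [eps_ge1 | eps_lt1] := leP 1 eps.
  apply: le_trans (ler0n _ _); rewrite mulr_le0_ge0 //.
  by rewrite mulr_le0_ge0 ?subr_le0 // invr_ge0 exprn_ge0 // ltW.
have n_large : 8 * K ^+ 2 <= eps * n%:R.
  rewrite [leRHS]mulrC -ler_pdivrMr //.
  suff /archi_boundP/ltW/le_trans : 0 <= 8 * K ^+ 2 / eps.
    by apply; rewrite ler_nat.
  by rewrite divr_ge0 ?mulr_ge0 ?exprn_ge0 // ltW.
have bound : 2 * n%:R ^+ 3 <= 3 * (K ^+ 2 * (4 * (nbad phi)%:R + 5 * n%:R ^+ 2)) :> rat.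
  have := nbad_lower_bound phi_mono k_odd.
  by rewrite -(ler_nat rat) !(natrM, natrD, natrX).
have bin3 : 6 * ('C(n, 3))%:R <= n%:R ^+ 3 :> rat.
  by have := bin3_le_cube n; rewrite -(ler_nat rat) natrM natrX.
rewrite mulrAC ler_pdivrMr ?exprn_gt0 //.
have : (1 - eps) * (6 * ('C(n, 3))%:R) <= (1 - eps) * n%:R ^+ 3.
  by rewrite ler_wpM2l // subr_ge0 ltW.
have : 8 * K ^+ 2 * n%:R ^+ 2 <= eps * n%:R * n%:R ^+ 2.
  by rewrite ler_wpM2r ?exprn_ge0.
have : 0 <= K ^+ 2 * n%:R ^+ 2 by rewrite mulr_ge0 // exprn_ge0 // ltW.
by rewrite exprS; lra.
Qed.
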